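(* Let $\alpha=\sqrt{13}-2$, $\beta=\sqrt{13}+2$, and consider the polynomial differential system in $\mathbb{R}^3$ $$\dot x=x\left(-\tfrac12x^2+\tfrac1\alpha x-\tfrac14y^2\right),\qquad \dot y=y\left(-\tfrac14x^2+\tfrac1\beta y-\tfrac12y^2\right),\qquad \dot z=-\tfrac z4(x^2+y^2).$$ Up to multiplication of $f$ by a nonzero real constant, the Darboux polynomials $f$ of degree $2$ of this system (equivalently, its invariant algebraic surfaces $f=0$ of degree $2$), together with their cofactors $k$, are exactly the following: - $f=z^2$, $k=-\frac{x^2}{2}-\frac{y^2}{2}$; - $f=x^2$, $k=-x^2-\frac{y^2}{2}+\frac{2x}{\alpha}$; - $f=y^2$, $k=-\frac{x^2}{2}-y^2+\frac{2y}{\beta}$; - $f=xy$, $k=-\frac{3x^2}{4}-\frac{3y^2}{4}+\frac{x}{\alpha}+\frac{y}{\beta}$; - $f=xz$, $k=-\frac{3x^2}{4}-\frac{y^2}{2}+\frac{x}{\alpha}$; - $f=yz$, $k=-\frac{x^2}{2}-\frac{3y^2}{4}+\frac{y}{\beta}$.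
   Context: Let $X=(P^1,P^2,P^3)$ be the polynomial vector field of the system, i.e. $\dot x=P^1$, $\dot y=P^2$, $\dot z=P^3$. A real polynomial $f\in\mathbb{R}[x,y,z]$ is a Darboux polynomial of the system if there is a real polynomial $k\in\mathbb{R}[x,y,z]$ of degree at most $2$ (the cofactor of $f$) with $(\nabla f)\cdot X=k f$. The surface $f(x,y,z)=0$ is then called an invariant algebraic surface, of degree $\deg f$. *)

(* Defs.v *)
From HB Require Import structures.
From mathcomp Require Import all_boot all_order all_algebra.
From mathcomp Require Import reals.
From mathcomp Require Import mpoly.

Set Implicit Arguments.
Unset Strict Implicit.
Unset Printing Implicit Defensive.

Import Order.TTheory GRing.Theory Num.Theory.
Local Open Scope ring_scope.

Definition vector_field (R : realType) (P1 P2 P3 : {mpoly R[3]}) :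
    3.-tuple {mpoly R[3]} := [tuple P1; P2; P3].

(* (\nabla f) . X *)
Definition lie_derivative (R : realType) (X : 3.-tuple {mpoly R[3]})
    (f : {mpoly R[3]}) : {mpoly R[3]} :=
  \sum_(i < 3) f^`M(i) * tnth X i.

(* [msize p] is the total degree of [p] plus one (and 0 for [p = 0]), so the
   bound below says deg k <= 2, as is natural for a cubic vector field. *)
Definition is_cofactor (R : realType) (X : 3.-tuple {mpoly R[3]})
    (f k : {mpoly R[3]}) : Prop :=
  (msize k <= 3)%N /\ lie_derivative X f = k * f.

Definition darboux_polynomial (R : realType) (X : 3.-tuple {mpoly R[3]})
    (f : {mpoly R[3]}) : Prop :=
  exists k : {mpoly R[3]}, is_cofactor X f k.

(* The zero polynomial ([msize 0 = 0]) has no degree. *)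
Definition has_degree (R : realType) (f : {mpoly R[3]}) (d : nat) : Prop :=
  msize f = d.+1.

(* Main.v *)
(* Every monomial x^i y^j z^l is a Darboux polynomial, and its cofactor determines
   (i, j, l), because the coefficients of x, y, x^2 and y^2 in it are i / alpha,
   j / beta, -(2i + j + l)/4 and -(i + 2j + l)/4. It thus suffices that no other
   polynomial of degree at most 2 is Darboux. Comparing the top powers of z shows
   that a cofactor k is free of z; then each coefficient of a power of z in f is
   a planar Darboux polynomial with cofactor k up to a multiple of x^2 + y^2.
   Equating coefficients for a planar quadratic leaves only monomials: candidates
   whose top part is (x + y)^2, (x - y)^2 or x (x + y), say, would be invariant
   for the quadratic part of the field only if 1 / alpha^2 = 1 / beta^2. *)

Require Import Defs.
From HB Require Import structures.
From mathcomp Require Import all_boot all_order all_algebra.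
From mathcomp Require Import reals.
From mathcomp Require Import mpoly.
From mathcomp Require Import boolp.
From mathcomp Require Import zify ring lra.

Set Implicit Arguments.
Unset Strict Implicit.
Unset Printing Implicit Defensive.

Import Order.TTheory GRing.Theory Num.Theory.
Local Open Scope ring_scope.

(* The coefficients of x^i y^j in L(A) = k A, where
   A = c + u x + v y + p x^2 + q x y + r y^2,
   k = k0 + k1 x + k2 y + k3 x^2 + k4 x y + k5 y^2 and L is the planar part of
   the vector field, with a = 1/alpha and b = 1/beta. *)
Record planar_system (R : realFieldType) (a b k0 k1 k2 k3 k4 k5 c u v p q r : R)
    : Prop := PlanarSystem {
  eq_00 : k0 * c = 0;
  eq_10 : k0 * u + k1 * c = 0;
  eq_01 : k0 * v + k2 * c = 0;
  eq_20 : k0 * p + (k1 - a) * u + k3 * c = 0;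
  eq_11 : k0 * q + k2 * u + k1 * v + k4 * c = 0;
  eq_02 : k0 * r + (k2 - b) * v + k5 * c = 0;
  eq_30 : (k1 - 2 * a) * p + (k3 + 1 / 2) * u = 0;
  eq_21 : (k1 - a) * q + k2 * p + (k3 + 1 / 4) * v + k4 * u = 0;
  eq_12 : (k2 - b) * q + k1 * r + (k5 + 1 / 4) * u + k4 * v = 0;
  eq_03 : (k2 - 2 * b) * r + (k5 + 1 / 2) * v = 0;
  eq_40 : (k3 + 1) * p = 0;
  eq_31 : (k3 + 3 / 4) * q + k4 * p = 0;
  eq_22 : (k5 + 1 / 2) * p + k4 * q + (k3 + 1 / 2) * r = 0;
  eq_13 : (k5 + 3 / 4) * q + k4 * r = 0;
  eq_04 : (k5 + 1) * r = 0 }.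

(** * Solution of the coefficient equations for planar quadratics *)

Section PlanarSystem.
Variable R : realFieldType.
Implicit Types a b c u v p q r : R.

(** Exchanging x and y preserves the planar field up to swapping a and b; this settles the cases of
    u and r from those of v and p. *)
Lemma planar_system_sym a b k0 k1 k2 k3 k4 k5 c u v p q r :
  planar_system a b k0 k1 k2 k3 k4 k5 c u v p q r ->
  planar_system b a k0 k2 k1 k5 k4 k3 c v u r q p.
Proof. by case=> *; split; lra. Qed.

(** The field has no constant or linear terms, so L raises degrees and only [k0] times the lowest
    part of A reaches the lowest degree. *)
Lemma planar_system_const a b k0 k1 k2 k3 k4 k5 c u v p q r :
  planar_system a b k0 k1 k2 k3 k4 k5 c u v p q r ->
  ~~ [&& c == 0, u == 0, v == 0, p == 0, q == 0 & r == 0] -> k0 = 0.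
Proof.
case=> e00 e10 e01 e20 e11 e02 _ _ _ _ _ _ _ _ _.
have [c0|/mulIf cI _] := eqVneq c 0; last by apply: cI; lra.
have [u0|/mulIf uI _] := eqVneq u 0; last by apply: uI; rewrite c0 in e10; lra.
have [v0|/mulIf vI _] := eqVneq v 0; last by apply: vI; rewrite c0 in e01; lra.
rewrite {}c0 {}u0 {}v0 in e20 e11 e02.
have [p0|/mulIf pI _] := eqVneq p 0; last by apply: pI; lra.
have [q0|/mulIf qI _] := eqVneq q 0; last by apply: qI; lra.
have [r0|/mulIf rI _] := eqVneq r 0; last by apply: rI; lra.
by [].
Qed.

(** Squaring b x = - a y and cancelling x^2 gives the claim. Candidates of the shapes (x + y)^2, (x
    - y)^2 and the like are excluded in this way. *)
Lemma sqr_eq_of_proportional a b x y :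
  x != 0 -> b * x + a * y = 0 -> x ^+ 2 = y ^+ 2 -> a ^+ 2 = b ^+ 2.
Proof.
move=> x_neq0 /eqP; rewrite addr_eq0 => /eqP bxE xyE.
apply: (mulIf (expf_neq0 2 x_neq0)).
by rewrite -[RHS]exprMn bxE sqrrN xyE exprMn.
Qed.

(** Both squares equal t x y. *)
Lemma sqr_eq_of_swap (t x y : R) : y = t * x -> x = t * y -> x ^+ 2 = y ^+ 2.
Proof. by move=> yE xE; rewrite !expr2 {1}xE -mulrA (mulrC y) mulrA -yE. Qed.

Section Solution.
Variables a b : R.
Hypotheses (a_neq0 : a != 0) (b_neq0 : b != 0) (sqr_neq : a ^+ 2 != b ^+ 2).

Section Const.
Variables k0 k1 k2 k3 k4 k5 c u v p q r : R.
Hypothesis sys : planar_system a b k0 k1 k2 k3 k4 k5 c u v p q r.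

(** A constant term kills [k0], [k1], [k2] and [k4], which leaves a u = k3 c and b v = k5 c. A
    nonzero q or u pins [k3] and [k5] to values for which one of these relations gives c = 0. *)
Lemma planar_system_c : c != 0 ->
  [/\ k1 = 0, k2 = 0, k3 = 0 & k5 = 0] /\
  [/\ u = 0, v = 0, p = 0, q = 0 & r = 0].
Proof.
move=> c_neq0; have cI := mulIf c_neq0.
case: sys => e00 e10 e01 e20 e11 e02 e30 e21 e12 e03 e40 e31 e22 e13 e04.
have k00 : k0 = 0 by apply: cI; lra.
have k10 : k1 = 0 by apply: cI; rewrite k00 in e10; lra.
have k20 : k2 = 0 by apply: cI; rewrite k00 in e01; lra.
have k40 : k4 = 0 by apply: cI; rewrite k00 k10 k20 in e11; lra.
rewrite {}k00 {}k10 {}k20 {}k40 in e20 e02 e30 e21 e12 e03 e31 e22 e13 *.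
have [q0|/mulIf qI] := eqVneq q 0; last first.
  have k3E : k3 = - (3 / 4) by apply: qI; lra.
  have k5E : k5 = - (3 / 4) by apply: qI; lra.
  rewrite {}k3E {}k5E in e20 e40 e30 e04 e03 e02.
  have p0 : p = 0 by lra.
  have r0 : r = 0 by lra.
  have u0 : u = 0 by rewrite p0 in e30; lra.
  have : c = 0 by rewrite u0 in e20; lra.
  by move/eqP; rewrite (negbTE c_neq0).
rewrite {}q0 in e21 e12 *.
have [u0|u_neq0] := eqVneq u 0; last first.
  have k5E : k5 = - (1 / 4) by apply: (mulIf u_neq0); lra.
  rewrite {}k5E in e02 e04 e22.
  have r0 : r = 0 by lra.
  have p0 : p = 0 by rewrite r0 in e22; lra.
  have k3E : k3 = - (1 / 2) by apply: (mulIf u_neq0); rewrite p0 in e30; lra.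
  rewrite {}k3E in e21.
  have v0 : v = 0 by lra.
  have : c = 0 by rewrite v0 in e02; lra.
  by move/eqP; rewrite (negbTE c_neq0).
rewrite {}u0 in e20 e30 *.
have k30 : k3 = 0 by apply: cI; lra.
rewrite {}k30 in e21 e40 *.
have v0 : v = 0 by lra.
rewrite {}v0 in e02 e03 *.
have k50 : k5 = 0 by apply: cI; lra.
rewrite {}k50 in e04 *.
by split; split=> //; lra.
Qed.

(** The quadratic equations give [k1 = a], [k2 = b] and b u + a v = 0, so u^2 = v^2 is absurd. If
    just one of p and r vanishes, then u or v does; otherwise the mixed cubic equations become v = 4
    k4 u and u = 4 k4 v. *)
Lemma planar_system_uv : c = 0 -> u != 0 -> v != 0 -> False.
Proof.
move=> c0 u_neq0 v_neq0.
have k00 : k0 = 0 by apply: (planar_system_const sys); rewrite (negbTE u_neq0) andbF.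
have uI := mulIf u_neq0; have vI := mulIf v_neq0.
case: sys => _ _ _; rewrite {}k00 {}c0.
move=> e20 e11 e02 e30 e21 e12 e03 e40 e31 e22 e13 e04.
have k1E : k1 = a by apply: uI; lra.
have k2E : k2 = b by apply: vI; lra.
rewrite {}k1E {}k2E in e11 e30 e21 e12 e03.
suff uvE : u ^+ 2 = v ^+ 2.
  case/eqP: sqr_neq; apply: (sqr_eq_of_proportional u_neq0 _ uvE); lra.
have [p0|/mulIf pI] := eqVneq p 0.
  have k3E : k3 = - (1 / 2) by apply: uI; rewrite p0 in e30; lra.
  rewrite {}p0 {}k3E in e21 e22 e31.
  have [r0|/mulIf rI] := eqVneq r 0.
    have k5E : k5 = - (1 / 2) by apply: vI; rewrite r0 in e03; lra.
    rewrite {}r0 {}k5E in e12 e13.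
    have q0 : q = 0 by lra.
    rewrite {}q0 in e21 e12.
    by apply: (@sqr_eq_of_swap (4 * k4)); lra.
  have k5E : k5 = -1 by apply: rI; lra.
  rewrite {}k5E in e03 e12 e13.
  have q0 : q = 0 by lra.
  have k40 : k4 = 0 by apply: rI; rewrite q0 in e13; lra.
  have v0 : v = 0 by rewrite q0 k40 in e21; lra.
  by case/eqP: v_neq0.
have k3E : k3 = -1 by apply: pI; lra.
rewrite {}k3E in e21 e22 e31 e30.
have [r0|/mulIf rI] := eqVneq r 0.
  have k5E : k5 = - (1 / 2) by apply: vI; rewrite r0 in e03; lra.
  rewrite {}r0 {}k5E in e12 e13.
  have q0 : q = 0 by lra.
  have k40 : k4 = 0 by apply: pI; rewrite q0 in e31; lra.
  have u0 : u = 0 by rewrite q0 k40 in e12; lra.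
  by case/eqP: u_neq0.
have k5E : k5 = -1 by apply: rI; lra.
rewrite {}k5E in e12 e03.
(* The relation b u + a v = 0 converts these pure cubic equations into values of b p and a r, the
   terms k2 p and k1 r of the mixed ones. *)
have apE : a * p = - (1 / 2) * u by lra.
have brE : b * r = - (1 / 2) * v by lra.
have bpE : b * p = 1 / 2 * v.
  apply: (mulfI a_neq0); have -> : a * (b * p) = b * (a * p) by ring.
  by rewrite apE; lra.
have arE : a * r = 1 / 2 * u.
  apply: (mulfI b_neq0); have -> : b * (a * r) = a * (b * r) by ring.
  by rewrite brE; lra.
by apply: (@sqr_eq_of_swap (4 * k4)); lra.
Qed.

(** A nonzero r is excluded because x^2 y^2 would require [k3] = -1/2 and x^2 y would require
    -1/4. *)
Lemma planar_system_v : c = 0 -> u = 0 -> v != 0 ->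
  [/\ k1 = 0, k2 = b, k3 = - (1 / 4) & k5 = - (1 / 2)] /\
  [/\ p = 0, q = 0 & r = 0].
Proof.
move=> c0 u0 v_neq0; have vI := mulIf v_neq0.
have k00 : k0 = 0.
  by apply: (planar_system_const sys); rewrite (negbTE v_neq0) !andbF.
case: sys => _ _ _; rewrite {}k00 {}c0 {}u0.
move=> e20 e11 e02 e30 e21 e12 e03 e40 e31 e22 e13 e04.
have k10 : k1 = 0 by apply: vI; lra.
have k2E : k2 = b by apply: vI; lra.
rewrite {}k10 {}k2E in e30 e21 e12 e03 *.
have p0 : p = 0 by apply: (mulfI a_neq0); lra.
rewrite {}p0 in e21 e22 e31 *.
have k40 : k4 = 0 by apply: vI; lra.
rewrite {}k40 in e21 e22 e31 e13.
have [r0|/mulIf rI] := eqVneq r 0.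
  have k5E : k5 = - (1 / 2) by apply: vI; rewrite r0 in e03; lra.
  rewrite {}r0 {}k5E in e13 *.
  have q0 : q = 0 by lra.
  rewrite {}q0 in e21 *.
  by split; split=> //; apply: vI; lra.
have k5E : k5 = -1 by apply: rI; lra.
have k3E : k3 = - (1 / 2) by apply: rI; lra.
rewrite {}k5E {}k3E in e13 e21.
have q0 : q = 0 by lra.
have : v = 0 by rewrite q0 in e21; lra.
by move/eqP; rewrite (negbTE v_neq0).
Qed.

Lemma planar_system_p : c = 0 -> u = 0 -> v = 0 -> p != 0 ->
  [/\ k1 = 2 * a, k2 = 0, k3 = -1 & k5 = - (1 / 2)] /\ (q = 0 /\ r = 0).
Proof.
move=> c0 u0 v0 p_neq0; have pI := mulIf p_neq0; have aI := mulfI a_neq0.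
have k00 : k0 = 0.
  by apply: (planar_system_const sys); rewrite (negbTE p_neq0) !andbF.
case: sys => _ _ _; rewrite {}k00 {}c0 {}u0 {}v0.
move=> e20 e11 e02 e30 e21 e12 e03 e40 e31 e22 e13 e04.
have k1E : k1 = 2 * a by apply: pI; lra.
have k3E : k3 = -1 by apply: pI; lra.
rewrite {}k1E {}k3E in e21 e12 e31 e22 *.
(* If r is nonzero, the quartic equations make A a multiple of (x + y)^2 or (x - y)^2, while a cubic
   one gives b q + 2 a p = 0. *)
have [r0|r_neq0] := eqVneq r 0; last first.
  have rI := mulIf r_neq0.
  have k2E : k2 = 2 * b by apply: rI; lra.
  have k5E : k5 = -1 by apply: rI; lra.
  rewrite {}k2E {}k5E in e21 e12 e22 e13.
  have q_neq0 : q != 0.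
    apply: contra_neq r_neq0 => q0.
    by rewrite q0 in e12; apply: aI; lra.
  have k4_neq0 : k4 != 0.
    by apply: contra_neq q_neq0 => k40; rewrite k40 in e31; lra.
  have rE : r = p by apply: (mulfI k4_neq0); lra.
  rewrite {}rE in e12 e22.
  case/eqP: sqr_neq.
  apply: (@sqr_eq_of_proportional _ _ q (2 * p)) => //; first by lra.
  by apply: (@sqr_eq_of_swap (2 * k4)); lra.
rewrite {}r0 in e12 e13 e22 *.
(* If q is nonzero, A is a multiple of x (x + y) or x (x - y), while the equation at x^2 y gives b p
   + a q = 0. *)
have [q0|q_neq0] := eqVneq q 0; last first.
  have k2E : k2 = b by apply: (mulIf q_neq0); lra.
  have k5E : k5 = - (3 / 4) by apply: (mulIf q_neq0); lra.
  rewrite {}k2E {}k5E in e21 e22.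
  case/eqP: sqr_neq; apply: (@sqr_eq_of_proportional _ _ p q) => //; first by lra.
  by apply: (@sqr_eq_of_swap (4 * k4)); lra.
rewrite {}q0 in e21 e31 e22 *.
have k40 : k4 = 0 by apply: pI; lra.
by split=> //; split=> //; apply: pI; lra.
Qed.

Lemma planar_system_q : c = 0 -> u = 0 -> v = 0 -> p = 0 -> r = 0 -> q != 0 ->
  [/\ k1 = a, k2 = b, k3 = - (3 / 4) & k5 = - (3 / 4)].
Proof.
move=> c0 u0 v0 p0 r0 q_neq0.
case: sys; rewrite c0 u0 v0 p0 r0 => *.
by split; apply: (mulIf q_neq0); lra.
Qed.

End Const.

(* The coefficients of x, y, x^2, y^2 in the cofactor of x^i y^j. *)
Definition weights (i j : nat) (k1 k2 k3 k5 : R) : Prop :=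
  [/\ k1 = i%:R * a, k2 = j%:R * b, k3 = - ((2 * i + j)%N%:R / 4)
    & k5 = - ((i + 2 * j)%N%:R / 4)].

End Solution.

(** The first nonzero coefficient in the order c, u, v, p, r, q forces all the others to vanish, so
    at most one of the premises holds. *)
Lemma planar_system_weights a b k0 k1 k2 k3 k4 k5 c u v p q r :
  a != 0 -> b != 0 -> a ^+ 2 != b ^+ 2 ->
  planar_system a b k0 k1 k2 k3 k4 k5 c u v p q r ->
  [/\ c != 0 -> weights a b 0 0 k1 k2 k3 k5,
      u != 0 -> weights a b 1 0 k1 k2 k3 k5,
      v != 0 -> weights a b 0 1 k1 k2 k3 k5 &
  [/\ p != 0 -> weights a b 2 0 k1 k2 k3 k5,
      q != 0 -> weights a b 1 1 k1 k2 k3 k5 &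
      r != 0 -> weights a b 0 2 k1 k2 k3 k5]].
Proof.
move=> a0 b0 ab sys; have sys' := planar_system_sym sys.
have ba : b ^+ 2 != a ^+ 2 by rewrite eq_sym.
have nz (x : R) (P : Prop) : x = 0 -> x != 0 -> P by move=> ->; rewrite eqxx.
have [c0|/(planar_system_c sys)] := eqVneq c 0; last first.
  case=> -[-> -> -> ->] [-> -> -> -> ->].
  by split=> [_|||]; last split=> //; try exact: nz; split; lra.
have [u0|u_neq0] := eqVneq u 0; last first.
  have [v0|/(planar_system_uv a0 b0 ab sys c0 u_neq0)//] := eqVneq v 0.
  have [[k2E k1E k5E k3E] [r0 q0 p0]] := planar_system_v b0 sys' c0 v0 u_neq0.
  by split=> [|_||]; last split=> //; try exact: nz; split; lra.
have [v0|v_neq0] := eqVneq v 0; last first.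
  have [[k1E k2E k3E k5E] [p0 q0 r0]] := planar_system_v a0 sys c0 u0 v_neq0.
  by split=> [||_|]; last split=> //; try exact: nz; split; lra.
split=> //; try exact: nz.
have [p0|p_neq0] := eqVneq p 0; last first.
  have [[k1E k2E k3E k5E] [q0 r0]] := planar_system_p a0 ab sys c0 u0 v0 p_neq0.
  by split=> [_||] //; try exact: nz; split; lra.
have [r0|r_neq0] := eqVneq r 0; last first.
  have [[k2E k1E k5E k3E] [q0 _]] := planar_system_p b0 ba sys' c0 v0 u0 r_neq0.
  by split=> [||_] //; try exact: nz; split; lra.
split=> //; try exact: nz.
by case/(planar_system_q sys c0 u0 v0 p0 r0) => *; split; lra.
Qed.

End PlanarSystem.

(** * Exponent triples and coefficients of monomial multiples *)

Lemma mcoeff_mulX (n : nat) (R : nzRingType) (p : {mpoly R[n]}) (m k : 'X_{1..n}) :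
  (p * 'X_[m])@_k = if (m <= k)%MM then p@_(k - m) else 0.
Proof.
case: ifP => [le_mk|/negP nle_mk]; first by rewrite -{1}(submK le_mk) addmC mcoeffMX.
rewrite mcoeffM big1 // => -[/= m1 m2] /eqP kE.
rewrite mcoeffX; case: eqP => [mE|_]; last by rewrite mulr0.
by case: nle_mk; rewrite kE -mE lem_addl.
Qed.

Definition mon (i j l : nat) : 'X_{1..3} := [multinom [tuple i; j; l]].

Lemma mon_eta (m : 'X_{1..3}) : m = mon (m 0) (m 1) (m 2).
Proof.
apply/mnmP => i; rewrite [RHS]multinomE /tnth.
by case: i => [[|[|[|]]] lt_i] //=; congr (m _); apply/val_inj.
Qed.

Lemma mon0 i j l : mon i j l 0 = i. Proof. by rewrite multinomE. Qed.
Lemma mon1 i j l : mon i j l 1 = j. Proof. by rewrite multinomE. Qed.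
Lemma mon2 i j l : mon i j l 2 = l. Proof. by rewrite multinomE. Qed.
Definition monE := (mon0, mon1, mon2).

Lemma mon_inj i j l s t u : mon i j l = mon s t u -> [/\ i = s, j = t & l = u].
Proof.
move=> e; split;
  [have := mon0 i j l | have := mon1 i j l | have := mon2 i j l];
  by rewrite e monE.
Qed.

Lemma mon_eqE i j l s t u : (mon i j l == mon s t u) = [&& i == s, j == t & l == u].
Proof. by apply/eqP/and3P => [/mon_inj[-> -> ->]//|[/eqP-> /eqP-> /eqP->]]. Qed.

Lemma forall_ord3 (P : 'I_3 -> Prop) : P 0 -> P 1 -> P 2 -> forall i, P i.
Proof.
move=> P0 P1 P2 [[|[|[|//]]] lt_i].
- by rewrite (_ : Ordinal lt_i = 0) //; apply/val_inj.
- by rewrite (_ : Ordinal lt_i = 1) //; apply/val_inj.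
- by rewrite (_ : Ordinal lt_i = 2) //; apply/val_inj.
Qed.

Lemma mon_le i j l s t u : (mon i j l <= mon s t u)%MM = [&& i <= s, j <= t & l <= u]%N.
Proof.
apply/mnm_lepP/and3P => [le_m|[le_i le_j le_l]].
  by have := (le_m 0, le_m 1, le_m 2); rewrite !monE => -[[]].
by apply: forall_ord3; rewrite !monE.
Qed.

Lemma mon_sub i j l s t u : (mon i j l - mon s t u)%MM = mon (i - s) (j - t) (l - u).
Proof. by apply/mnmP; apply: forall_ord3; rewrite mnmBE !monE. Qed.

Lemma mdeg_mon i j l : mdeg (mon i j l) = (i + j + l)%N.
Proof. by rewrite mdegE !big_ord_recl big_ord0 /= addn0 addnA. Qed.

Lemma mpolyX_mon (R : nzRingType) i j l :
  'X_[mon i j l] = 'X_0 ^+ i * 'X_1 ^+ j * 'X_2 ^+ l :> {mpoly R[3]}.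
Proof.
rewrite mpolyXE_id !big_ord_recl big_ord0 mulr1 mulrA monE.
rewrite (_ : lift _ _ = 1) ?monE; last exact/val_inj.
by rewrite (_ : lift _ _ = 2) ?monE; last exact/val_inj.
Qed.

(** Euler operators are diagonal on monomials. Each component of the field is divisible by its own
    variable, so the Lie derivative is a combination of these operators. *)
Lemma mcoeff_euler (R : nzRingType) (i : 'I_3) (f : {mpoly R[3]}) m :
  (f^`M(i) * 'X_i)@_m = f@_m *+ m i.
Proof.
rewrite mcoeff_mulX; case: ifP => [le_im|].
  rewrite mcoeff_deriv submK // mnmBE mnm1E eqxx subn1 prednK //.
  by move/mnm_lepP: le_im => /(_ i); rewrite mnm1E eqxx.
move/mnm_lepP => nle; case mi: (m i) => [//|n]; case: nle => j.
by rewrite mnm1E; case: eqP => // <-; rewrite mi.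
Qed.

(** * Products of planar polynomials as families of coefficients *)

Section PlanarConvolution.
Variable R : realFieldType.
Implicit Types K G : nat -> nat -> R.

(* The families [G i j] are coefficients of x^i y^j; [shift s t] multiplies by
   x^s y^t. *)
Definition shift (s t : nat) (G : nat -> nat -> R) (i j : nat) : R :=
  if (s <= i)%N && (t <= j)%N then G (i - s)%N (j - t)%N else 0.

(* This is the coefficient of a product only when [K s t] vanishes for
   [s >= 3] or [t >= 3]. *)
Definition conv (K G : nat -> nat -> R) (i j : nat) : R :=
  \sum_(s < 3) \sum_(t < 3) K s t * shift s t G i j.

Lemma conv_eq0r K G : (forall i j, G i j = 0) -> forall i j, conv K G i j = 0.
Proof.
move=> G0 i j; rewrite /conv big1 // => s _; rewrite big1 // => t _.
by rewrite /shift; case: ifP => _; rewrite ?G0 mulr0.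
Qed.

Lemma conv_eq0l K G : (forall i j, K i j = 0) -> forall i j, conv K G i j = 0.
Proof.
move=> K0 i j; rewrite /conv big1 // => s _; rewrite big1 // => t _.
by rewrite K0 mul0r.
Qed.

Local Ltac cancel k0 k1 I :=
  (have k00 : k0 = 0 by apply: I; lra); subst k0;
  (have k10 : k1 = 0 by apply: I; lra); subst k1; split=> //; apply: I; lra.

(** The first nonzero coefficient of G in the order 1, x, y, x^2, x y, y^2 successively cancels the
    three coefficients of K. *)
Lemma conv_affine_eq0 K G :
  (forall s t, (1 < s + t)%N -> K s t = 0) ->
  (forall i j, (2 < i + j)%N -> G i j = 0) ->
  (forall i j, conv K G i j = 0) ->
  (exists i j, G i j != 0) -> forall s t, K s t = 0.
Proof.
move=> degK degG KG0 [i0 [j0 G_neq0]].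
suff [K00 K10 K01] : [/\ K 0%N 0%N = 0, K 1%N 0%N = 0 & K 0%N 1%N = 0].
  by move=> [|[|s]] [|[|t]] //; apply: degK; rewrite ?addnS ?addSn.
have E i j : K 0%N 0%N * G i j + K 1%N 0%N * shift 1 0 G i j
    + K 0%N 1%N * shift 0 1 G i j = 0.
  rewrite -[RHS](KG0 i j) /conv !big_ord_recr !big_ord0 /=.
  rewrite !(degK 1%N 1%N, degK 2%N, degK _ 2%N) //.
  by rewrite /shift /= !leq0n !andbT !subn0 !mul0r; ring.
have /= := (E 0 0, E 1 0, E 0 1, E 2 0, E 1 1, E 0 2,
            E 3 0, E 2 1, E 1 2, E 0 3)%N.
rewrite /shift /= !subn0 !subn1 /=.
rewrite !(degG 3 0, degG 0 3, degG 2 1, degG 1 2)%N //.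
have {i0 j0 G_neq0} : ~ [/\ G 0%N 0%N = 0, G 1%N 0%N = 0, G 0%N 1%N = 0 &
    [/\ G 2%N 0%N = 0, G 1%N 1%N = 0 & G 0%N 2%N = 0]].
  case=> G00 G10 G01 [G20 G11 G02]; case/eqP: G_neq0.
  by case: i0 j0 => [|[|[|i0]]] [|[|[|j0]]] //; apply: degG; rewrite ?addSn ?addnS.
move: (K 0 0)%N (K 1 0)%N (K 0 1)%N => k0 k1 k2.
move: (G 0 0)%N (G 1 0)%N (G 0 1)%N (G 2 0)%N (G 1 1)%N (G 0 2)%N => c u v p q r.
move=> nz [[[[[[[[[e00 e10] e01] e20] e11] e02] e30] e21] e12] e03].
have [c0|/mulIf I] := eqVneq c 0; last by cancel k0 k1 I.
subst c; have [u0|/mulIf I] := eqVneq u 0; last by cancel k0 k1 I.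
subst u; have [v0|/mulIf I] := eqVneq v 0; last by cancel k0 k1 I.
subst v; have [p0|/mulIf I] := eqVneq p 0; last by cancel k0 k1 I.
subst p; have [q0|/mulIf I] := eqVneq q 0; last by cancel k0 k1 I.
subst q; have [r0|/mulIf I] := eqVneq r 0; last by cancel k0 k1 I.
by case: nz; rewrite r0.
Qed.

End PlanarConvolution.

(** * Slicing polynomials by powers of z *)

Section Slices.
Variable R : realFieldType.
Implicit Types f k : {mpoly R[3]}.

Lemma mcoeff_mon_eq0 n f i j l : (msize f <= n)%N -> (n <= i + j + l)%N ->
  f@_(mon i j l) = 0.
Proof.
move=> le_f le_n; apply: memN_msupp_eq0; apply: msize_mdeg_ge.
by rewrite mdeg_mon (leq_trans le_f).
Qed.

(** The exponents range over a cube, which makes the three sums independent; the terms of total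
    degree above 2 are zero. *)
Lemma quadratic_expansion f : (msize f <= 3)%N ->
  f = \sum_(s < 3) \sum_(t < 3) \sum_(u < 3) f@_(mon s t u) *: 'X_[mon s t u].
Proof.
move=> le_f; apply/mpolyP => m; rewrite (mon_eta m).
move: (m 0) (m 1) (m 2) => i j l; rewrite raddf_sum /=.
under eq_bigr do (rewrite raddf_sum /=; under eq_bigr do (rewrite raddf_sum /=;
  under eq_bigr do rewrite mcoeffZ mcoeffX mon_eqE)).
have [lt_ijl|ge_ijl] := ltnP (i + j + l) 3; last first.
  have f0 := mcoeff_mon_eq0 le_f ge_ijl.
  rewrite f0 big1 // => s _; rewrite big1 // => t _; rewrite big1 // => u _.
  case: and3P => [[/eqP-> /eqP-> /eqP->]|_]; last by rewrite mulr0.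
  by rewrite f0 mul0r.
have lt_i : (i < 3)%N by apply: leq_ltn_trans lt_ijl; rewrite -addnA leq_addr.
have lt_j : (j < 3)%N by apply: leq_ltn_trans lt_ijl; rewrite addnAC leq_addl.
have lt_l : (l < 3)%N by apply: leq_ltn_trans lt_ijl; rewrite leq_addl.
rewrite (bigD1 (Ordinal lt_i)) //= (bigD1 (Ordinal lt_j)) //=.
rewrite (bigD1 (Ordinal lt_l)) //= !eqxx mulr1 !big1 ?addr0 // => [s|s|s].
- rewrite -val_eqE /= => /negbTE neq.
  rewrite big1 // => t _; rewrite big1 // => u _.
  by rewrite neq mulr0.
- rewrite -val_eqE /= => /negbTE neq; rewrite big1 // => t _.
  by rewrite neq ?andbF mulr0.
- rewrite -val_eqE /= => /negbTE neq.
  by rewrite neq ?andbF mulr0.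
Qed.

Definition slice f (l i j : nat) : R := f@_(mon i j l).

(** After expanding k, the sum over its powers of z is moved outermost. The test [u <= l] guards the
    truncated subtraction [l - u]. *)
Lemma mcoeff_mul_quadratic k f i j l : (msize k <= 3)%N ->
  (k * f)@_(mon i j l) =
  \sum_(u < 3) if (u <= l)%N then conv (slice k u) (slice f (l - u)) i j else 0.
Proof.
move=> le_k; rewrite {1}(quadratic_expansion le_k) mulr_suml raddf_sum /=.
under eq_bigr do (rewrite mulr_suml raddf_sum /=;
  under eq_bigr do (rewrite mulr_suml raddf_sum /=;
  under eq_bigr do rewrite -scalerAl mcoeffZ (mulrC 'X_[_]) mcoeff_mulX
    mon_le mon_sub)).
under eq_bigr do rewrite exchange_big /=.
rewrite exchange_big /=; apply: eq_bigr => u _.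
case: ifP => le_u; last first.
  by rewrite big1 // => s _; rewrite big1 // => t _; rewrite !andbF mulr0.
by do 2! apply: eq_bigr => ? _; rewrite /shift !andbT.
Qed.

End Slices.

(** * The cubic field with parameters a and b *)

Section CubicField.
Variable R : realType.
Variables a b : R.
Notation x := ('X_0 : {mpoly R[3]}).
Notation y := ('X_1 : {mpoly R[3]}).
Notation z := ('X_2 : {mpoly R[3]}).

(** The rates are the cofactors of x, y and z. *)
Definition rate_x : {mpoly R[3]} := - (1 / 2) *: x ^+ 2 + a *: x - (1 / 4) *: y ^+ 2.
Definition rate_y : {mpoly R[3]} := - (1 / 4) *: x ^+ 2 + b *: y - (1 / 2) *: y ^+ 2.
Definition rate_z : {mpoly R[3]} := - ((1 / 4) *: (x ^+ 2 + y ^+ 2)).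
Definition cubic_field : 3.-tuple {mpoly R[3]} :=
  vector_field (x * rate_x) (y * rate_y) (- ((1 / 4) *: z) * (x ^+ 2 + y ^+ 2)).

Lemma lie_cubic_fieldE f : lie_derivative cubic_field f =
  (f^`M(0) * x) * rate_x + (f^`M(1) * y) * rate_y + (f^`M(2) * z) * rate_z.
Proof.
rewrite /lie_derivative !big_ord_recl big_ord0 addr0 addrA !(tnth_nth 0) /=.
rewrite (_ : lift _ _ = 1); last exact/val_inj.
rewrite (_ : lift _ _ = 2); last exact/val_inj.
by rewrite !mulrA /rate_z !mulrN mulNr -!scalerAr -scalerAl.
Qed.

(* The action of the vector field on the coefficients of z^l. *)
Definition planar_lie (l : nat) (G : nat -> nat -> R) (i j : nat) : R :=
  a * shift 1 0 (fun i j => i%:R * G i j) i j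
  + b * shift 0 1 (fun i j => j%:R * G i j) i j
  - shift 2 0 (fun i j => (2 * i + j + l)%N%:R / 4 * G i j) i j
  - shift 0 2 (fun i j => (i + 2 * j + l)%N%:R / 4 * G i j) i j.

Lemma planar_lie_eq0 l (G : nat -> nat -> R) :
  (forall i j, G i j = 0) -> forall i j, planar_lie l G i j = 0.
Proof.
move=> G0 i j; rewrite /planar_lie /shift.
by do !case: ifP => _; rewrite ?G0 ?mulr0 ?oppr0 ?addr0.
Qed.

Lemma rate_xE :
  rate_x = - (1 / 2) *: 'X_[mon 2 0 0] + a *: 'X_[mon 1 0 0]
    - (1 / 4) *: 'X_[mon 0 2 0].
Proof. by rewrite /rate_x !mpolyX_mon !expr0 !mul1r !mulr1. Qed.

Lemma rate_yE :
  rate_y = - (1 / 4) *: 'X_[mon 2 0 0] + b *: 'X_[mon 0 1 0]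
    - (1 / 2) *: 'X_[mon 0 2 0].
Proof. by rewrite /rate_y !mpolyX_mon !expr0 !mul1r !mulr1. Qed.

Lemma rate_zE : rate_z = - (1 / 4) *: 'X_[mon 2 0 0] - (1 / 4) *: 'X_[mon 0 2 0].
Proof. by rewrite /rate_z !mpolyX_mon !expr0 !mul1r !mulr1 scalerDr opprD scaleNr. Qed.

Lemma mcoeff_lie f i j l :
  (lie_derivative cubic_field f)@_(mon i j l) = planar_lie l (slice f l) i j.
Proof.
rewrite lie_cubic_fieldE rate_xE rate_yE rate_zE !mulrDr !mulrN -!scalerAr.
rewrite !(mcoeffD, mcoeffN, mcoeffZ) !(mcoeff_mulX _ (mon _ _ _)).
rewrite !mon_le !mon_sub !mcoeff_euler !monE.
rewrite !leq0n !andbT !subn0 /planar_lie /shift /slice !andbT /= !subn0 !natrD.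
by do !case: ifP => _; field.
Qed.

(** Cofactors add under multiplication of Darboux polynomials. *)
Definition mon_cofactor i j l : {mpoly R[3]} :=
  i%:R *: rate_x + j%:R *: rate_y + l%:R *: rate_z.

Lemma lie_mon i j l : lie_derivative cubic_field 'X_[mon i j l] =
  mon_cofactor i j l * 'X_[mon i j l].
Proof.
have E (c : 'I_3) : 'X_[mon i j l]^`M(c) * 'X_c =
    (mon i j l c)%:R *: 'X_[mon i j l] :> {mpoly R[3]}.
  apply/mpolyP => m; rewrite mcoeff_euler mcoeffZ mcoeffX.
  by case: eqP => [->|_]; rewrite ?mulr1 ?mulr0 ?mul0rn.
by rewrite lie_cubic_fieldE !E !monE -!scalerAl !scalerAr -!mulrDr mulrC.
Qed.
Lemma msize_mon_cofactor i j l : (msize (mon_cofactor i j l) <= 3)%N.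
Proof.
have D (p q : {mpoly R[3]}) : (msize p <= 3 -> msize q <= 3 -> msize (p + q) <= 3)%N.
  by move=> le_p le_q; rewrite (leq_trans (msizeD_le _ _)) // geq_max le_p.
have Z (c : R) (p : {mpoly R[3]}) : (msize p <= 3 -> msize (c *: p) <= 3)%N.
  exact/leq_trans/msizeZ_le.
rewrite /mon_cofactor rate_xE rate_yE rate_zE.
have X s t u : (s + t + u <= 2 -> msize ('X_[mon s t u] : {mpoly R[3]}) <= 3)%N.
  by rewrite msizeX mdeg_mon.
apply/D; [apply/D|]; apply/Z; rewrite -?scaleNr; repeat apply/D; exact/Z/X.
Qed.

Lemma is_cofactor_mon (c : R) i j l :
  is_cofactor cubic_field (c *: 'X_[mon i j l]) (mon_cofactor i j l).
Proof.
split; first exact: msize_mon_cofactor.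
rewrite -scalerAr -lie_mon /lie_derivative scaler_sumr.
by apply: eq_bigr => c' _; rewrite mderivZ scalerAl.
Qed.

(** * Darboux polynomials of degree at most 2 are monomials *)

Section Rigidity.
Hypotheses (a_neq0 : a != 0) (b_neq0 : b != 0) (sqr_neq : a ^+ 2 != b ^+ 2).

(** The factor z^l contributes -(l/4)(x^2 + y^2). Moving this term to the side of K yields the
    planar system with [k3] and [k5] shifted by l/4. *)
Lemma conv_planar_lie_weights l (K G : nat -> nat -> R) :
  (forall s t, (2 < s + t)%N -> K s t = 0) ->
  (forall i j, (2 < i + j)%N -> G i j = 0) ->
  (forall i j, conv K G i j = planar_lie l G i j) ->
  forall i j, G i j != 0 ->
  weights a b i j (K 1 0)%N (K 0 1)%N
    ((K 2 0)%N + l%:R / 4) ((K 0 2)%N + l%:R / 4).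
Proof.
move=> degK degG E.
have sys : planar_system a b (K 0 0)%N (K 1 0)%N (K 0 1)%N
    ((K 2 0)%N + l%:R / 4) (K 1 1)%N ((K 0 2)%N + l%:R / 4)
    (G 0 0)%N (G 1 0)%N (G 0 1)%N (G 2 0)%N (G 1 1)%N (G 0 2)%N.
  have {}E i j : K 0%N 0%N * shift 0 0 G i j + K 1%N 0%N * shift 1 0 G i j
      + K 0%N 1%N * shift 0 1 G i j + K 2%N 0%N * shift 2 0 G i j
      + K 1%N 1%N * shift 1 1 G i j + K 0%N 2%N * shift 0 2 G i j
      = planar_lie l G i j.
    rewrite -E /conv !big_ord_recr !big_ord0 /=.
    by rewrite !(degK 2%N 1%N, degK 1%N 2%N, degK 2%N 2%N) //; ring.
  split; [have := (E 0 0)%N | have := (E 1 0)%N | have := (E 0 1)%N | have := (E 2 0)%N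
    | have := (E 1 1)%N | have := (E 0 2)%N | have := (E 3 0)%N | have := (E 2 1)%N
    | have := (E 1 2)%N | have := (E 0 3)%N | have := (E 4 0)%N | have := (E 3 1)%N
    | have := (E 2 2)%N | have := (E 1 3)%N | have := (E 0 4)%N];
  rewrite /planar_lie /shift /= ?subSS ?subn0;
  rewrite ?(degG 3 0, degG 2 1, degG 1 2, degG 0 3)%N
    ?(degG 4 0, degG 3 1, degG 2 2, degG 1 3, degG 0 4)%N //;
  rewrite ?(natrD _ _ l) ?muln0 ?muln1 ?addn0 ?add0n -?[(2 * 2)%N]/4%N; lra.
have [w00 w10 w01 [w20 w11 w02]] :=
  planar_system_weights a_neq0 b_neq0 sqr_neq sys.
by case=> [|[|[|i]]] [|[|[|j]]] //; rewrite degG ?eqxx // ?addSn ?addnS.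
Qed.

Section Darboux.
Variables f k : {mpoly R[3]}.
Hypotheses (le_f : (msize f <= 3)%N) (fk : is_cofactor cubic_field f k).

Let recE i j l : planar_lie l (slice f l) i j =
  \sum_(u < 3) if (u <= l)%N then conv (slice k u) (slice f (l - u)) i j else 0.
Proof. by case: fk => le_k E; rewrite -mcoeff_mul_quadratic // -E mcoeff_lie. Qed.

Let deg_k l i j : (2 < i + j + l)%N -> slice k l i j = 0.
Proof. by apply: mcoeff_mon_eq0; case: fk. Qed.

Let deg_f l i j : (2 < i + j + l)%N -> slice f l i j = 0.
Proof. exact: mcoeff_mon_eq0. Qed.

(* Comparing the coefficients of z^(l+1) and z^(l+2), where z^l is the highest
   power of z in f, shows that the cofactor does not involve z. *)
Lemma top_slice l : (exists i j, slice f l i j != 0) ->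
  (forall m i j, (l < m)%N -> slice f m i j = 0) ->
  (forall i j, slice k 1 i j = 0) /\ (forall i j, slice k 2 i j = 0).
Proof.
move=> nz top.
have degf i j : (2 < i + j)%N -> slice f l i j = 0.
  by move=> lt; apply: deg_f; rewrite ltn_addr.
have k2 i j : slice k 2 i j = 0.
  apply: (conv_affine_eq0 _ degf _ nz) => [s t lt|{}i {}j].
    by apply: deg_k; rewrite addn2 ltnS ltnW.
  have conv0 u : (u < 2)%N -> conv (slice k u) (slice f (l.+2 - u)) i j = 0.
    by move=> lt_u; apply: conv_eq0r => *; apply: top; lia.
  have := recE i j l.+2; rewrite planar_lie_eq0; last by move=> *; apply: top; lia.
  rewrite !big_ord_recr big_ord0 /= (conv0 0%N) // (conv0 1%N) // !add0r.
  by rewrite !subSS subn0 => <-.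
split=> //; move=> i j.
apply: (conv_affine_eq0 _ degf _ nz) => [s t lt|{}i {}j].
  by apply: deg_k; rewrite addn1 ltnS.
have := recE i j l.+1; rewrite planar_lie_eq0; last by move=> *; apply: top; lia.
have conv0 : conv (slice k 0) (slice f (l.+1 - 0)) i j = 0.
  by apply: conv_eq0r => *; apply: top; lia.
rewrite !big_ord_recr big_ord0 /= conv0 (conv_eq0l _ k2) !add0r.
by rewrite subSS subn0 if_same addr0 => <-.
Qed.

(** Once k is free of z, each slice of f satisfies a planar equation with the same K, so every
    monomial present in f prescribes the weights of k. *)
Lemma cofactor_weights i j l : slice f l i j != 0 ->
  weights a b i j (slice k 0 1 0) (slice k 0 0 1)
    (slice k 0 2 0 + l%:R / 4) (slice k 0 0 2 + l%:R / 4).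
Proof.
move=> f_ijl.
have [k1 k2] : (forall i j, slice k 1 i j = 0) /\ (forall i j, slice k 2 i j = 0).
  have zero m : ~ (exists i j, slice f m i j != 0) -> forall i j, slice f m i j = 0.
    by move=> nex s t; apply/eqP; apply: contra_notT nex => ?; exists s, t.
  have big_slice m s t : (2 < m)%N -> slice f m s t = 0.
    by move=> lt; apply: deg_f; rewrite ltn_addl.
  (* The top power of z in f is 2, 1 or 0; in the last case the given nonzero coefficient must lie
     in slice 0. *)
  have [nz2|/zero z2] := pselect (exists i j, slice f 2 i j != 0).
    exact: top_slice nz2 big_slice.
  have [nz1|/zero z1] := pselect (exists i j, slice f 1 i j != 0).
    by apply: (top_slice nz1) => -[|[|[|m]]] s t // _; apply: big_slice.
  apply: (@top_slice 0); last by move=> [|[|[|m]]] s t // _; apply: big_slice.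
  exists i, j; case: l f_ijl => [|[|[|m]]] //; first by rewrite z1 eqxx.
    by rewrite z2 eqxx.
  by rewrite big_slice ?eqxx.
apply: (conv_planar_lie_weights _ _ _ f_ijl) => [s t lt|s t lt|s t].
- by apply: deg_k; rewrite addn0.
- by apply: deg_f; rewrite ltn_addr.
rewrite recE !big_ord_recr big_ord0 /= add0r subn0.
by rewrite (conv_eq0l _ k1) (conv_eq0l _ k2) !if_same !addr0.
Qed.

(* The weights of the cofactor determine the exponents (i, j, l). *)
Lemma darboux_monomial : f != 0 -> exists i j l,
  f = f@_(mon i j l) *: 'X_[mon i j l] /\ f@_(mon i j l) != 0.
Proof.
move=> f_neq0.
have [m f_m] : exists m, f@_m != 0.
  by exists (mlead f); rewrite mleadc_eq0.
exists (m 0), (m 1), (m 2); rewrite -mon_eta; split=> //.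
apply/mpolyP => m'; rewrite mcoeffZ mcoeffX.
case: eqP => [->|ne]; first by rewrite mulr1.
rewrite mulr0; apply/eqP; apply: contra_notT ne => f_m'.
move: f_m f_m'; rewrite (mon_eta m) (mon_eta m').
move: (m 0) (m 1) (m 2) (m' 0) (m' 1) (m' 2) => i j l i' j' l'.
move=> /cofactor_weights[k1 k2 k3 _] /cofactor_weights[k1' k2' k3' _].
have natI (s t : nat) : s%:R = t%:R :> R -> s = t.
  by move/eqP; rewrite eqr_nat => /eqP.
have ii' : i = i' by apply: natI; apply: (mulIf a_neq0); rewrite -k1 k1'.
have jj' : j = j' by apply: natI; apply: (mulIf b_neq0); rewrite -k2 k2'.
(* With i and j known, the weight of x^2 determines l. *)
by subst i' j'; congr (mon _ _ _); apply: natI; lra.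
Qed.

End Darboux.

Lemma darboux_quadraticP (f k : {mpoly R[3]}) :
  (has_degree f 2 /\ is_cofactor cubic_field f k) <->
  exists i j l (c : R), [/\ (i + j + l = 2)%N, c != 0,
    f = c *: 'X_[mon i j l] & k = mon_cofactor i j l].
Proof.
split=> [[deg_f fk]|[i [j [l [c [deg c0 -> ->]]]]]]; last first.
  split; last exact: is_cofactor_mon.
  by rewrite /has_degree msizeZ // msizeX mdeg_mon deg.
have f_neq0 : f != 0 by rewrite -msize_poly_eq0 deg_f.
have le_f : (msize f <= 3)%N by rewrite deg_f.
have [i [j [l [fE c_neq0]]]] := darboux_monomial le_f fk f_neq0.
exists i, j, l, f@_(mon i j l); split=> //.
  by move: deg_f; rewrite /has_degree fE msizeZ // msizeX mdeg_mon => -[].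
(* A nonzero polynomial has at most one cofactor, so k is the one already known for the monomial. *)
have [_ E] := is_cofactor_mon f@_(mon i j l) i j l.
by apply: (mulIf f_neq0); rewrite -(proj2 fk) {2}fE -E -fE.
Qed.
End Rigidity.
End CubicField.

(** * The explicit list and the final classification *)

Section Table.
Variable R : realType.
Variables alpha beta : R.
Notation x := ('X_0 : {mpoly R[3]}).
Notation y := ('X_1 : {mpoly R[3]}).
Notation z := ('X_2 : {mpoly R[3]}).

(** Indexing the list by the exponent triples of sum 2 reduces membership to a finite check on
    exponents. *)
Lemma quad_tableE : [:: (z ^+ 2, - (1 / 2) *: x ^+ 2 - (1 / 2) *: y ^+ 2);
        (x ^+ 2, - x ^+ 2 - (1 / 2) *: y ^+ 2 + (2 / alpha) *: x);
        (y ^+ 2, - (1 / 2) *: x ^+ 2 - y ^+ 2 + (2 / beta) *: y);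
        (x * y, - (3 / 4) *: x ^+ 2 - (3 / 4) *: y ^+ 2
                + (1 / alpha) *: x + (1 / beta) *: y);
        (x * z, - (3 / 4) *: x ^+ 2 - (1 / 2) *: y ^+ 2 + (1 / alpha) *: x);
        (y * z, - (1 / 2) *: x ^+ 2 - (3 / 4) *: y ^+ 2 + (1 / beta) *: y)] =
  [seq ('X_[mon m.1.1 m.1.2 m.2],
        mon_cofactor (1 / alpha) (1 / beta) m.1.1 m.1.2 m.2) |
    m <- [:: (0, 0, 2); (2, 0, 0); (0, 2, 0); (1, 1, 0); (1, 0, 1); (0, 1, 1)]%N].
Proof.
rewrite /mon_cofactor /rate_x /rate_y /rate_z /= !mpolyX_mon.
rewrite !expr0 !expr1 !mul1r !mulr1.
(* Rational scalings are turned into integer multiples of [h *: v], so that [ring] can compare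
   them. *)
set h := 4^-1 : R.
have E2 (v : {mpoly R[3]}) : 2^-1 *: v = (h *: v) *+ 2.
  by rewrite -scaler_nat scalerA; congr (_ *: _); rewrite /h; field.
have E1 (v : {mpoly R[3]}) : v = (h *: v) *+ 4.
  by rewrite -scaler_nat scalerA /h divff ?scale1r ?pnatr_eq0.
have E3 (v : {mpoly R[3]}) : (3 / 4) *: v = (h *: v) *+ 3.
  by rewrite -scaler_nat scalerA.
have E2a (c : R) (v : {mpoly R[3]}) : (2 / c) *: v = (c^-1 *: v) *+ 2.
  by rewrite -scaler_nat scalerA.
rewrite !scale0r !scale1r !(scaler_nat 2) !E3 !E2a !scaleNr !E2 !E3 !scalerDr.
congr [:: (_, _); (_, _); (_, _); (_, _); (_, _); (_, _)]; try ring.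
  by rewrite {1}(E1 ('X_0 ^+ 2)); ring.
by rewrite {1}(E1 ('X_1 ^+ 2)); ring.
Qed.
End Table.

Theorem proposition4p5 (R : realType) :
  let alpha : R := Num.sqrt 13 - 2 in
  let beta : R := Num.sqrt 13 + 2 in
  let x : {mpoly R[3]} := 'X_0 in
  let y : {mpoly R[3]} := 'X_1 in
  let z : {mpoly R[3]} := 'X_2 in
  let X : 3.-tuple {mpoly R[3]} :=
    vector_field
      (x * (- (1 / 2) *: x ^+ 2 + (1 / alpha) *: x - (1 / 4) *: y ^+ 2))
      (y * (- (1 / 4) *: x ^+ 2 + (1 / beta) *: y - (1 / 2) *: y ^+ 2))
      (- ((1 / 4) *: z) * (x ^+ 2 + y ^+ 2)) in
  let table : seq ({mpoly R[3]} * {mpoly R[3]}) :=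
    [:: (z ^+ 2, - (1 / 2) *: x ^+ 2 - (1 / 2) *: y ^+ 2);
        (x ^+ 2, - x ^+ 2 - (1 / 2) *: y ^+ 2 + (2 / alpha) *: x);
        (y ^+ 2, - (1 / 2) *: x ^+ 2 - y ^+ 2 + (2 / beta) *: y);
        (x * y, - (3 / 4) *: x ^+ 2 - (3 / 4) *: y ^+ 2
                + (1 / alpha) *: x + (1 / beta) *: y);
        (x * z, - (3 / 4) *: x ^+ 2 - (1 / 2) *: y ^+ 2 + (1 / alpha) *: x);
        (y * z, - (1 / 2) *: x ^+ 2 - (3 / 4) *: y ^+ 2 + (1 / beta) *: y)] in
  forall f k : {mpoly R[3]},
    (darboux_polynomial X f /\ has_degree f 2 /\ is_cofactor X f k) <->
    (exists c : R, c != 0 /\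
       exists p : {mpoly R[3]} * {mpoly R[3]},
         p \in table /\ f = c *: p.1 /\ k = p.2).
Proof.
move=> alpha beta x y z X table f k.
(* Since 13 > 4, the constants satisfy 0 < alpha < beta; hence their inverses are nonzero with
   distinct squares. *)
have s_gt2 : 2 < Num.sqrt 13 :> R.
  by rewrite -[ltLHS]ger0_norm // -sqrtr_sqr ltr_sqrt // -natrX ltr_nat.
have al_gt0 : 0 < alpha by rewrite /alpha subr_gt0.
have be_gt : alpha < beta by rewrite /alpha /beta; lra.
have be_gt0 := lt_trans al_gt0 be_gt.
have a_neq0 : 1 / alpha != 0 by rewrite mul1r invr_eq0 gt_eqF.
have b_neq0 : 1 / beta != 0 by rewrite mul1r invr_eq0 gt_eqF.
have sqr_neq : (1 / alpha) ^+ 2 != (1 / beta) ^+ 2.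
  by rewrite !mul1r !exprVn (inj_eq invr_inj) eqrXn2 ?ltW // lt_eqF.
have P := darboux_quadraticP a_neq0 b_neq0 sqr_neq f k.
rewrite /table (quad_tableE alpha beta); split.
  case=> _ /P[i [j [l [c [deg c_neq0 fE kE]]]]].
  exists c; split=> //.
  exists ('X_[mon i j l], mon_cofactor (1 / alpha) (1 / beta) i j l).
  split=> //; apply/mapP; exists (i, j, l) => //.
  by move: i j l deg {fE kE} => [|[|[|i]]] [|[|[|j]]] [|[|[|l]]].
case=> c [c_neq0 [p [/mapP[[[i j] l] ijl ->] [fE kE]]]].
have fk : has_degree f 2 /\ is_cofactor X f k.
  apply/P; exists i, j, l, c; split=> //.
  by move: ijl; rewrite !inE => /or4P[|||/or3P[]] /eqP[-> -> ->].
by case: fk => deg_f fk; split; first by exists k.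
Qed.
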